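(* For a Hausdorff (infinite) space $X$ the following conditions are equivalent: (1) $X$ is almost H-closed; (2) the posets $\mathbf{H}(X)$ and $\mathbf{OF}(X)$ are order isomorphic; (3) the poset $\mathbf{OF}(X)$ is a complete distributive lattice; (4) the poset $\mathbf{OF}(X)$ is a lattice.
   Context: All topological spaces are assumed to be Hausdorff and infinite. Filters are proper. Lattices are understood to be nonempty. A filter $\mathcal F$ on a space $X$ is open if it has a base consisting of open sets; it is an open ultrafilter if it is open and for every open $A\subseteq X$ either $A\in\mathcal F$ or $X\setminus A\in\mathcal F$ (equivalently, it is maximal with respect to inclusion among open filters on $X$); it is free if every $x\in X$ has an open neighborhood $U$ with $X\setminus U\in\mathcal F$. $\mathbf{OF}(X)$ is the set of all free open filters on $X$, partially ordered by inclusion. $X$ is H-closed if $\mathbf{OF}(X)=\emptyset$. $X$ is almost H-closed if it admits a unique (exactly one) free open ultrafilter. An H-extension of $X$ is a Hausdorff H-closed space $Y$ containing $X$ as a dense subspace. Two H-extensions of $X$ are equivalent if there is a homeomorphism between them fixing the points of $X$, and equivalent H-extensions are identified. $\mathbf{H}(X)$ is the set of all H-extensions of $X$, partially ordered by: $Y\le Z$ if there exists a continuous surjection $f:Z\to Y$ such that $f(x)=x$ for every $x\in X$. A lattice is distributive if $x\wedge(y\vee z)=(x\wedge y)\vee(x\wedge z)$ for all $x,y,z$. *)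

(* Defs.v *)
From HB Require Import structures.
From mathcomp Require Import all_boot all_order all_classical topology.

Set Implicit Arguments.
Unset Strict Implicit.
Unset Printing Implicit Defensive.

Import Order.TTheory.
Local Open Scope classical_set_scope.

Section OpenFilters.
Variable X : topologicalType.
Implicit Types F : set_system X.

Definition open_filter F : Prop :=
  ProperFilter F /\
  forall A, F A -> exists U : set X, [/\ open U, F U & U `<=` A].

Definition open_ultrafilter F : Prop :=
  open_filter F /\ forall A : set X, open A -> F A \/ F (~` A).

Definition free F : Prop :=
  forall x : X, exists U : set X, [/\ open U, U x & F (~` U)].

Definition free_open_filters : set (set_system X) :=
  [set F | open_filter F /\ free F].

Definition H_closed : Prop := free_open_filters = set0.

Definition almost_H_closed : Prop :=
  exists! F : set_system X, open_ultrafilter F /\ free F.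

Definition OF : Type := set_type free_open_filters.
HB.instance Definition _ := SubType.on OF.
HB.instance Definition _ := Choice.on OF.
HB.instance Definition _ :=
  [SubChoice_isSubPOrder of OF by <: with set_display].

Lemma OF_leE (F G : OF) : (F <= G)%O = (set_val F `<=` set_val G) :> Prop.
Proof. by rewrite -subsetEset. Qed.

End OpenFilters.

Section Lattices.
Variables (d : Order.disp_t) (P : porderType d).

Definition lattice_ops (meet join : P -> P -> P) : Prop :=
  forall x y, infimums [set x; y] (meet x y) /\
              supremums [set x; y] (join x y).

Definition is_lattice : Prop :=
  [set: P] !=set0 /\ exists meet join, lattice_ops meet join.

Definition is_complete_distributive_lattice : Prop :=
  [/\ [set: P] !=set0,
      forall A : set P, infimums A !=set0 /\ supremums A !=set0 &
      exists meet join, lattice_ops meet join /\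
        forall x y z, meet x (join y z) = join (meet x y) (meet x z)].

End Lattices.

Definition embedding (X Y : topologicalType) (e : X -> Y) : Prop :=
  [/\ injective e, continuous e &
      forall U : set X, open U -> exists2 V : set Y, open V & U = e @^-1` V].

(* The inclusion of X in an H-extension is a dense embedding. Carriers may be
   restricted to the universe of topologicalType without loss: a Hausdorff space
   with a dense copy of X has cardinality at most 2 ^ (2 ^ #|X|), so it is
   homeomorphic to a space on a subset of set (set X). *)
Record Hext (X : topologicalType) := MkHext {
  Hext_space :> topologicalType;
  Hext_emb : X -> Hext_space;
  Hext_hausdorff : hausdorff_space Hext_space;
  Hext_H_closed : H_closed Hext_space;
  Hext_embedding : embedding Hext_emb;
  Hext_dense : dense (range Hext_emb) }.
Arguments Hext_emb {X} Y x : rename.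

Section HExtensions.
Variable X : topologicalType.
Implicit Types Y Z : Hext X.

Definition Hext_equiv Y Z : Prop :=
  exists (f : Y -> Z) (g : Z -> Y),
    [/\ continuous f, continuous g, cancel f g, cancel g f &
        forall x, f (Hext_emb Y x) = Hext_emb Z x].

Definition Hext_le Y Z : Prop :=
  exists f : Z -> Y,
    [/\ continuous f, forall y, exists z, f z = y &
        forall x, f (Hext_emb Z x) = Hext_emb Y x].

(* The elements of H(X) are the classes of Hext_equiv. They live in a universe
   above that of porderType and set, so H(X) gets a plain Prop-valued order,
   shown below to be a partial order computed on any representatives. *)
Definition Hexts : Type := {C : Hext X -> Prop | exists Y, C = Hext_equiv Y}.

Definition H_class Y : Hexts := exist _ (Hext_equiv Y) (ex_intro _ Y erefl).

Definition H_le (C D : Hexts) : Prop :=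
  exists Y Z, [/\ sval C Y, sval D Z & Hext_le Y Z].

Lemma Hext_equiv_refl Y : Hext_equiv Y Y.
Proof. by exists id, id; split=> //; move=> y; exact: cvg_id. Qed.

Lemma Hext_equiv_sym Y Z : Hext_equiv Y Z -> Hext_equiv Z Y.
Proof.
by move=> [f [g [cf cg fK gK fE]]]; exists g, f; split => // x; rewrite -fE.
Qed.

Lemma Hext_equiv_trans Y Z T :
  Hext_equiv Y Z -> Hext_equiv Z T -> Hext_equiv Y T.
Proof.
move=> [f [g [cf cg fK gK fE]]] [f' [g' [cf' cg' fK' gK' fE']]].
exists (f' \o f), (g \o g'); split.
- by move=> y; apply: continuous_comp; [exact: cf | exact: cf'].
- by move=> t; apply: continuous_comp; [exact: cg' | exact: cg].
- exact: can_comp.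
- exact: can_comp.
- by move=> x /=; rewrite fE.
Qed.

Lemma Hext_equiv_le Y Z : Hext_equiv Y Z -> Hext_le Y Z.
Proof.
move=> [f [g [cf cg fK gK fE]]]; exists g; split => // [y|x].
  by exists (f y).
by rewrite -fE.
Qed.

Lemma Hext_le_trans Y Z T : Hext_le Y Z -> Hext_le Z T -> Hext_le Y T.
Proof.
move=> [f [cf sf fE]] [g [cg sg gE]]; exists (f \o g); split => [t|y|x /=].
- by apply: continuous_comp; [exact: cg | exact: cf].
- by have [z <-] := sf y; have [t <-] := sg z; exists t.
- by rewrite gE.
Qed.

Lemma Hext_rigid Y (f : Y -> Y) :
  continuous f -> (forall x, f (Hext_emb Y x) = Hext_emb Y x) -> f =1 id.
Proof.
move=> cf fE y; apply/eqP/negP => /negP fy.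
have := @Hext_hausdorff _ Y; rewrite open_hausdorff => /(_ _ _ fy).
move=> [[A B] /= [/set_mem Afy /set_mem By] [oA oB AB0]].
have [||z [[/= Afz Bz] [x _ xz]]] := @Hext_dense _ Y (f @^-1` A `&` B).
- by exists y.
- by apply: openI => //; apply: open_comp.
- have : (A `&` B) z by split=> //; move: Afz; rewrite -xz fE.
  by rewrite (eqP AB0).
Qed.

Lemma Hext_le_anti Y Z : Hext_le Y Z -> Hext_le Z Y -> Hext_equiv Y Z.
Proof.
move=> [g [cg sg gE]] [f [cf sf fE]]; exists f, g; split => //.
- apply: (@Hext_rigid Y (g \o f)) => [y|x /=]; last by rewrite fE.
  by apply: continuous_comp; [exact: cf | exact: cg].
- apply: (@Hext_rigid Z (f \o g)) => [y|x /=]; last by rewrite gE.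
  by apply: continuous_comp; [exact: cg | exact: cf].
Qed.

Lemma H_classP Y Z : H_class Y = H_class Z <-> Hext_equiv Y Z.
Proof.
split=> [/(congr1 sval) /= ->|YZ]; first exact: Hext_equiv_refl.
apply: eq_exist; apply/funext => T; apply/propext; split.
- by apply: Hext_equiv_trans; exact: Hext_equiv_sym.
- exact: Hext_equiv_trans.
Qed.

Lemma H_class_surj (C : Hexts) : exists Y, C = H_class Y.
Proof. by case: C => C [Y CE]; exists Y; exact: eq_exist. Qed.

Lemma H_leE Y Z : H_le (H_class Y) (H_class Z) <-> Hext_le Y Z.
Proof.
split=> [[Y' [Z' [/= YY' ZZ' le']]]|YZ].
  apply: Hext_le_trans (Hext_equiv_le YY') _; apply: Hext_le_trans le' _.
  exact/Hext_equiv_le/Hext_equiv_sym.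
by exists Y, Z; split => //; exact: Hext_equiv_refl.
Qed.

Lemma H_le_refl (C : Hexts) : H_le C C.
Proof.
have [Y ->] := H_class_surj C.
exact/H_leE/Hext_equiv_le/Hext_equiv_refl.
Qed.

Lemma H_le_trans (C D E : Hexts) : H_le C D -> H_le D E -> H_le C E.
Proof.
have [Y ->] := H_class_surj C; have [Z ->] := H_class_surj D.
have [T ->] := H_class_surj E.
by move=> /H_leE YZ /H_leE ZT; exact/H_leE/(Hext_le_trans YZ).
Qed.

Lemma H_le_anti (C D : Hexts) : H_le C D -> H_le D C -> C = D.
Proof.
have [Y ->] := H_class_surj C; have [Z ->] := H_class_surj D.
by move=> /H_leE YZ /H_leE ZY; exact/H_classP/Hext_le_anti.
Qed.

End HExtensions.

Definition order_isomorphic (S T : Type)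
    (leS : S -> S -> Prop) (leT : T -> T -> Prop) : Prop :=
  exists f : S -> T, bijective f /\ forall x y, leS x y <-> leT (f x) (f y).

(* Main.v *)
(* Every space X + I, whose new points i have the sets i |: A (A in F i) as basic
   neighbourhoods for some free open filters F i, is an H-extension as soon as
   the F i are separated and every free open ultrafilter is finer than some F i.
   Taking all free open ultrafilters gives the Katetov extension, the maximum of
   H(X). If H(X) and OF(X) are isomorphic, OF(X) thus has a maximum, and two
   free open ultrafilters with a common upper bound in OF(X) are equal; the
   same remark applies when OF(X) is a lattice.
   Conversely, let p be the only free open ultrafilter. Every free open filter
   lies below p, so each H-extension has exactly one new point, whose trace on X
   determines it, and F |-> X + {F} is an isomorphism from OF(X) onto H(X).
   Moreover ~` U is in all free open filters when it is in p and U is open,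
   so that any intersection of free open filters is again free, while the
   filter generated by two free open filters is proper, being contained in p;
   this makes OF(X) a complete distributive lattice. *)
From HB Require Import structures.
Require Import Defs.
From mathcomp Require Import all_boot all_order all_classical topology.

Set Implicit Arguments.
Unset Strict Implicit.
Unset Printing Implicit Defensive.

Import Order.TTheory.
Local Open Scope classical_set_scope.

(** * Open filters and open ultrafilters on a space *)

Section OpenFilterTheory.
Variable X : topologicalType.
Implicit Types (F G p q : set_system X) (U V A B : set X).

Lemma open_filter_from (D : set_system X) :
    (exists U, D U) -> (forall U V, D U -> D V -> D (U `&` V)) ->
    (forall U, D U -> open U /\ U !=set0) ->
  open_filter (filter_from D id).
Proof.
move=> D0 DI Dop; split=> [|A [U DU UA]].
  apply: filter_from_proper => [|U /Dop[]//].
  by apply: filter_from_filter => // U V DU DV; exists (U `&` V) => //; exact: DI.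
by exists U; split => //; [case: (Dop _ DU) | exists U].
Qed.

Lemma open_filter_setCF F A : open_filter F -> F A -> F (~` A) -> False.
Proof.
move=> [FF _] FA FnA; have [x []] := filter_ex (filterI FA FnA); exact.
Qed.

Lemma open_filter_setC F U :
  open_filter F -> open U -> ~ F (~` U) ->
  forall A, F A -> A `&` U !=set0.
Proof.
move=> [FF _] oU nFU A FA; apply/set0P/negP => /eqP AU0.
apply: nFU; apply: filterS FA => x Ax Ux.
by have : (A `&` U) x by []; rewrite AU0.
Qed.

(** An open set that misses U lies in the interior of [~] U[. A filter containing all dense open
    sets thus has to decide between U and](~[U)°]. *)
Lemma open_dense_setUCo U :
  open U -> open (U `|` (~` U)°) /\ dense (U `|` (~` U)°).
Proof.
move=> oU; split=> [|O [x Ox] oO].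
  by apply: openU => //; exact: open_interior.
have [[y [Oy Uy]]|OU0] := pselect (O `&` U !=set0).
  by exists y; split => //; left.
exists x; split => //; right; suff : O `<=` (~` U)° by exact.
by rewrite -open_subsetE // => y Oy Uy; apply: OU0; exists y.
Qed.

(* An ultrafilter finer than F and all dense open sets contains, for U open,
   either U or the interior of its complement; so its open members generate
   an open ultrafilter. *)
Lemma open_ultrafilter_extend F U :
    open_filter F -> open U -> ~ F (~` U) ->
  exists p, [/\ open_ultrafilter p, F `<=` p & p U].
Proof.
move=> oF oU nFU.
pose D := [set W | exists V O, [/\ F V, open V, open O, dense O &
  W = (V `&` U) `&` O]].
have FT : F setT by case: oF => FF _; exact: filterT.
have dT : dense [set: X] by move=> O O0 _; rewrite setIT.
have oD : open_filter (filter_from D id).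
  apply: open_filter_from => [|? ?|?].
  - by exists ((setT `&` U) `&` setT), setT, setT; split => //; exact: openT.
  - move=> [V [O [FV oV oO dO ->]]] [V' [O' [FV' oV' oO' dO' ->]]].
    exists (V `&` V'), (O `&` O'); split; [|exact: openI|exact: openI| |].
    + by case: oF => FF _; exact: filterI.
    + move=> W W0 oW; rewrite setIA; apply: dO'; [exact: dO | exact: openI].
    + by rewrite setIACA [V `&` U `&` _]setIACA setIid.
  - move=> [V [O [FV oV oO dO ->]]].
    split; first by apply: openI => //; exact: openI.
    by apply: dO; [exact: (open_filter_setC oF) | exact: openI].
have [G [GU DG]] := ultraFilterLemma oD.1.
have GF := @ultra_proper _ _ GU.
exists (filter_from [set V | open V /\ G V] id); split; first split.
- apply: open_filter_from => [|V W [oV GV] [oW GW]|V [oV GV]].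
  + by exists setT; split; [exact: openT | exact: filterT].
  + by split; [exact: openI | exact: filterI].
  + by split => //; exact: filter_ex GV.
- move=> V oV; have [GV|GnV] := in_ultra_setVsetC V GU; first by left; exists V.
  right; exists (~` V)°; last exact: interior_subset.
  split; first exact: open_interior.
  have [oE dE] := open_dense_setUCo oV.
  have GE : G (V `|` (~` V)°).
    apply: DG; exists ((setT `&` U) `&` (V `|` (~` V)°)); last by move=> x [].
    by exists setT, (V `|` (~` V)°); split => //; exact: openT.
  by apply: filterS (filterI GE GnV) => x [[]].
- move=> A FA; have [V [oV FV VA]] := oF.2 _ FA.
  exists V => //; split => //; apply: DG; exists ((V `&` U) `&` setT).
    by exists V, setT; split => //; exact: openT.
  by move=> x [[]].
- exists U => //; split => //; apply: DG; exists ((setT `&` U) `&` setT).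
    by exists setT, setT; split => //; exact: openT.
  by move=> x [[]].
Qed.

Lemma open_ultrafilter_above F :
  open_filter F -> exists2 p, open_ultrafilter p & F `<=` p.
Proof.
move=> oF; have [||p [up Fp _]] := @open_ultrafilter_extend F setT oF.
- exact: openT.
- by rewrite setCT; case: oF => FF _; exact: filter_not_empty.
- by exists p.
Qed.

(** An open member of F outside p would have its complement in p, hence in F. *)
Lemma open_ultrafilter_max p F :
  open_ultrafilter p -> open_filter F -> p `<=` F -> F = p.
Proof.
move=> [[pF _] up] oF pF'; apply/seteqP; split => // A FA.
have [U [oU FU UA]] := oF.2 _ FA.
have [pU|pnU] := up U oU; first exact: filterS pU.
by case: (open_filter_setCF oF FU); exact: pF'.
Qed.

Lemma free_sub F G : F `<=` G -> free F -> free G.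
Proof.
by move=> FG fF x; have [U [oU Ux FU]] := fF x; exists U; split => //; exact: FG.
Qed.

(** Upward closure needs no supersets in the formula: if [A]&[B] is inside C, then C is the
    intersection of [A]|[C] and [B]|[C]. *)
Definition filter_join F G : set_system X :=
  [set C | exists A B, [/\ F A, G B & C = A `&` B]].

Lemma filter_joinl F G : open_filter G -> F `<=` filter_join F G.
Proof.
by move=> [GF _] A FA; exists A, setT; rewrite setIT; split => //; exact: filterT.
Qed.

Lemma filter_joinr F G : open_filter F -> G `<=` filter_join F G.
Proof.
by move=> [FF _] A GA; exists setT, A; rewrite setTI; split => //; exact: filterT.
Qed.

Lemma filter_join_sub F G p :
  open_filter p -> F `<=` p -> G `<=` p -> filter_join F G `<=` p.
Proof.
by move=> [pF _] Fp Gp _ [A [B [/Fp pA /Gp pB ->]]]; exact: filterI.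
Qed.

(** The common upper bound p keeps the join from containing [set0]. *)
Lemma filter_join_open F G p :
  open_filter p -> open_filter F -> open_filter G -> F `<=` p -> G `<=` p ->
  open_filter (filter_join F G).
Proof.
move=> op oF oG Fp Gp; have [[[FF _] [GF _]] [pF _]] := (oF, oG, op); split.
  split=> [/(filter_join_sub op Fp Gp)|]; first exact: filter_not_empty.
  split=> [|_ _ [A [B [FA GB ->]]] [A' [B' [FA' GB' ->]]]|D C sC [A [B [FA GB E]]]].
  - by apply: (filter_joinl oG); exact: filterT.
  - by exists (A `&` A'), (B `&` B'); rewrite setIACA; split => //; exact: filterI.
  - exists (A `|` C), (B `|` C); rewrite -setUIl; split.
    + by apply: filterS FA => x; left.
    + by apply: filterS GB => x; left.
    + by rewrite setUidr // -E.
move=> _ [A [B [FA GB ->]]].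
have [U [oU FU UA]] := oF.2 _ FA; have [V [oV GV VB]] := oG.2 _ GB.
by exists (U `&` V); split; [exact: openI | exists U, V | exact: setISS].
Qed.

(** The source of distributivity: when [A]&[B] is in F, so are its supersets A and B. Below they are
    written as unions with [A]&[B]. *)
Lemma filter_joinI F G H : open_filter F -> open_filter G -> open_filter H ->
  F `&` filter_join G H = filter_join (F `&` G) (F `&` H).
Proof.
move=> [FF _] [GF _] [HF _]; apply/seteqP; split=> [C [FC [A [B [GA HB E]]]]|].
  rewrite {C}E in FC *; exists (A `|` (A `&` B)), (B `|` (A `&` B)).
  rewrite -setUIl setUid; split => //; split.
  - by apply: filterS FC => x; right.
  - by apply: filterS GA => x; left.
  - by apply: filterS FC => x; right.
  - by apply: filterS HB => x; left.
by move=> ? [A [B [[FA GA] [FB HB] ->]]]; split; [exact: filterI | exists A, B].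
Qed.

Lemma open_filter_bigcap (I : Type) (D : set I) (F : I -> set_system X) :
    D !=set0 -> (forall i, D i -> open_filter (F i)) ->
  open_filter (\bigcap_(i in D) F i).
Proof.
move=> [i0 Di0] oF; split.
  split=> [/(_ _ Di0)|]; first by case: (oF _ Di0) => ? _; exact: filter_not_empty.
  split=> [i /oF[? _]|A B FA FB i Di|A B AB FA i Di].
  - exact: filterT.
  - by have [? _] := oF _ Di; apply: filterI; [exact: FA | exact: FB].
  - by have [? _] := oF _ Di; apply: filterS AB _; exact: FA.
(* The open witness may vary with i, but each one lies in the interior of A, which therefore serves
   for all i. *)
move=> A FA; exists A°; split; [exact: open_interior| |exact: interior_subset].
move=> i Di; have [? oFi] := oF _ Di; have [U [oU FU UA]] := oFi _ (FA _ Di).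
by apply: filterS FU; rewrite -open_subsetE.
Qed.

End OpenFilterTheory.

(** * The poset of free open filters *)

Section OFTheory.
Variable X : topologicalType.
Implicit Types (F G : OF X).

Definition members F : set_system X := set_val F.

Lemma membersP F : free_open_filters (members F).
Proof. exact: set_valP. Qed.

Lemma members_open F : open_filter (members F).
Proof. by case: (membersP F). Qed.

Lemma members_free F : free (members F).
Proof. by case: (membersP F). Qed.

Lemma members_leE F G : (F <= G)%O <-> members F `<=` members G.
Proof. by rewrite OF_leE. Qed.

Lemma members_inj : injective members.
Proof. exact: val_inj. Qed.

Definition mkOF (p : set_system X) (op : open_filter p) (fp : free p) : OF X :=
  exist _ p (mem_set (conj op fp : free_open_filters p)).

Lemma members_mk p op fp : members (@mkOF p op fp) = p.
Proof. by []. Qed.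

(** Only upper bounds of pairs are asked for, so that both a maximum and a binary join can supply
    them. *)
Lemma directed_almost_H_closed :
  [set: OF X] !=set0 -> (forall F G, exists H, (F <= H)%O /\ (G <= H)%O) ->
  almost_H_closed X.
Proof.
move=> [F _] dir.
have [p up Fp] := open_ultrafilter_above (members_open F).
have fp := free_sub Fp (@members_free F).
exists p; split=> [//|q [uq fq]].
have [H [/members_leE pH /members_leE qH]] := dir (mkOF up.1 fp) (mkOF uq.1 fq).
by rewrite -(open_ultrafilter_max up (members_open H) pH)
           -(open_ultrafilter_max uq (members_open H) qH).
Qed.

(** * Lattice structure of OF(X) under a unique free open ultrafilter *)

Section Almost.
Variable p : set_system X.
Hypotheses (up : open_ultrafilter p) (fp : free p).
Hypothesis p_unique : forall q, open_ultrafilter q /\ free q -> p = q.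

Lemma almost_top F : members F `<=` p.
Proof.
have [q uq Fq] := open_ultrafilter_above (members_open F).
by rewrite (p_unique (conj uq (free_sub Fq (@members_free F)))).
Qed.

(* If F avoided ~` U, adjoining U to F would give a second free open
   ultrafilter. *)
Lemma almost_setC F U : open U -> p (~` U) -> members F (~` U).
Proof.
move=> oU pnU; apply: contrapT => nFU.
have [q [uq Fq qU]] := open_ultrafilter_extend (members_open F) oU nFU.
have pq := p_unique (conj uq (free_sub Fq (@members_free F))).
by apply: (open_filter_setCF uq.1 qU); rewrite -pq.
Qed.

Definition almost_join F G : OF X :=
  mkOF (filter_join_open up.1 (members_open F) (members_open G)
          (@almost_top F) (@almost_top G))
       (free_sub (@filter_joinl _ (members F) (members G) (members_open G))
          (@members_free F)).

Lemma almost_bigcap_free (D : set (OF X)) :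
  free (\bigcap_(F in D) members F).
Proof.
move=> x; have [U [oU Ux pnU]] := fp x; exists U; split => // F _.
exact: almost_setC.
Qed.

Lemma almost_meetE F G :
  members F `&` members G = \bigcap_(H in [set F; G]) members H.
Proof. by rewrite bigcap_setU !bigcap_set1. Qed.

Lemma almost_meet_open F G : open_filter (members F `&` members G).
Proof.
rewrite almost_meetE; apply: open_filter_bigcap => [|H _].
  by exists F; left.
exact: members_open.
Qed.

Lemma almost_meet_free F G : free (members F `&` members G).
Proof. by rewrite almost_meetE; exact: almost_bigcap_free. Qed.

Definition almost_meet F G : OF X :=
  mkOF (almost_meet_open F G) (almost_meet_free F G).

Lemma almost_infimum (D : set (OF X)) : infimums D !=set0.
Proof.
have [D0|D0] := pselect (D !=set0); last first.
  (* The infimum of the empty family is the greatest element p. *)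
  exists (mkOF up.1 fp); split=> [F DF|F _]; first by case: D0; exists F.
  exact/members_leE/almost_top.
exists (mkOF (open_filter_bigcap D0 (fun F _ => members_open F))
          (@almost_bigcap_free D)).
split=> [F DF|F lbF]; apply/members_leE => A FA; first exact: FA.
by move=> G DG; apply/members_leE: A FA; exact: lbF.
Qed.

Lemma almost_complete_distributive : is_complete_distributive_lattice (OF X).
Proof.
split.
- by exists (mkOF up.1 fp).
- move=> D; split; first exact: almost_infimum.
  (* The supremum of D is the infimum of its upper bounds. *)
  have [G [lbG ubG]] := almost_infimum (ubound D).
  by exists G; split=> // F DF; apply: ubG => H ubH; exact: ubH.
exists almost_meet, almost_join; split=> [F G|F G H]; last first.
  by apply: members_inj; rewrite !members_mk; apply: filter_joinI; exact: members_open.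
split; split.
- by move=> H [->|->]; apply/members_leE => A [].
- move=> H lbH; apply/members_leE => A HA.
  by split; apply/members_leE: A HA; apply: lbH; [left | right].
- move=> H [->|->]; apply/members_leE.
    exact/filter_joinl/members_open.
  exact/filter_joinr/members_open.
- move=> H ubH; apply/members_leE; apply: filter_join_sub; first exact: members_open.
    by apply/members_leE; apply: ubH; left.
  by apply/members_leE; apply: ubH; right.
Qed.

End Almost.
End OFTheory.

Lemma hausdorffP (T : topologicalType) : hausdorff_space T <->
  forall x y : T, x <> y -> exists A B : set T,
    [/\ open A, open B, A x, B y & forall z, A z -> B z -> False].
Proof.
rewrite open_hausdorff; split=> H x y.
  move=> /eqP/H[[A B] /= [/set_mem Ax /set_mem By] [oA oB /eqP AB0]].
  exists A, B; split=> // z Az Bz.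
  by have : (A `&` B) z by []; rewrite AB0.
move=> /eqP/H[A [B [oA oB Ax By AB]]].
exists (A, B); first by split; apply/mem_set.
by split => //; apply/eqP/seteqP; split => // z [Az /(AB _ Az)].
Qed.

(* F is a phantom argument on which the topology will depend. *)
Definition simple_ext (X : topologicalType) (I : Type) (F : I -> OF X) : Type :=
  (X + I)%type.

(** * Simple extensions of X by a family of free open filters *)

Section SimpleExtension.
Variables (X : topologicalType) (I : Type) (F : I -> OF X).
Local Notation simple_ext := (simple_ext F).

HB.instance Definition _ := gen_eqMixin simple_ext.
HB.instance Definition _ := gen_choiceMixin simple_ext.

Definition simple_inl (x : X) : simple_ext := inl x.

(** X becomes an open subspace, and the new points form a closed discrete set. *)
Definition simple_open : set_system simple_ext :=
  [set W | open (simple_inl @^-1` W) /\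
           forall i, W (inr i) -> members (F i) (simple_inl @^-1` W)].

Lemma simple_openT : simple_open setT.
Proof.
split=> [|i _]; first exact: openT.
by have [[? _] _] := membersP (F i); exact: filterT.
Qed.

Lemma simple_openI : setI_closed simple_open.
Proof.
move=> A B [oA FA] [oB FB]; split; first exact: openI.
move=> i [Ai Bi]; have [[? _] _] := membersP (F i).
by apply: filterI; [exact: FA | exact: FB].
Qed.

Lemma simple_open_bigU (J : Type) (f : J -> set simple_ext) :
  (forall j, simple_open (f j)) -> simple_open (\bigcup_j f j).
Proof.
move=> of_; split=> [|i [j _ fji]].
  by apply: bigcup_open => j _; case: (of_ j).
have [[? _] _] := membersP (F i).
by have /filterS := (of_ j).2 _ fji; apply=> x ?; exists j.
Qed.

HB.instance Definition _ := isOpenTopological.Build simple_ext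
  simple_openT simple_openI simple_open_bigU.

Lemma simple_ext_openE (W : set simple_ext) : open W = simple_open W.
Proof. by []. Qed.

Lemma simple_ext_open_inr i (U : set X) : open U -> members (F i) U ->
  open [set z : simple_ext | match z with inl x => U x | inr j => j = i end].
Proof. by rewrite simple_ext_openE => oU FU; split=> // j ->. Qed.

Lemma simple_ext_open_inl (U : set X) : open U ->
  open [set z : simple_ext | if z is inl x then U x else False].
Proof. by rewrite simple_ext_openE => oU; split. Qed.

Lemma simple_inl_embedding : embedding simple_inl.
Proof.
split=> [x y []//||U oU].
- by apply/continuousP => W [].
- by exists [set z : simple_ext | if z is inl x then U x else False];
    [exact: simple_ext_open_inl|].
Qed.

Lemma simple_inl_dense : dense (range simple_inl).
Proof.
move=> W [[x|i] Wz] [oW FW]; first by exists (inl x); split => //; exists x.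
have [[? _] _] := membersP (F i).
by have [x Wx] := filter_ex (FW _ Wz); exists (inl x); split => //; exists x.
Qed.

Lemma simple_ext_sep_inlr (x : X) (i : I) : exists A B : set simple_ext,
  [/\ open A, open B, A (inl x), B (inr i) & forall z, A z -> B z -> False].
Proof.
have [U [oU Ux FnU]] := @members_free _ (F i) x.
have [V [oV FV VU]] := (members_open (F i)).2 _ FnU.
exists [set z : simple_ext | if z is inl x then U x else False].
exists [set z : simple_ext | match z with inl x => V x | inr j => j = i end].
split => //; first exact: simple_ext_open_inr.
by case=> [z /= Uz /VU|].
Qed.

Lemma simple_ext_hausdorff : hausdorff_space X ->
    (forall i j, i <> j -> exists A B,
      [/\ members (F i) A, members (F j) B & A `&` B = set0]) ->
  hausdorff_space simple_ext.
Proof.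
move=> /hausdorffP hX sepF; apply/hausdorffP => -[x|i] [y|j] xy.
- have [|A [B [oA oB Ax By AB]]] := hX x y; first by move=> E; rewrite E in xy.
  exists [set z : simple_ext | if z is inl x then A x else False].
  exists [set z : simple_ext | if z is inl x then B x else False].
  split => //.
  by case=> // z; exact: AB.
- exact: simple_ext_sep_inlr.
- have [A [B [oA oB Ay Bi AB]]] := simple_ext_sep_inlr y i.
  by exists B, A; split=> // z Bz Az; exact: (AB z).
- have ij : i <> j by move=> E; rewrite E in xy.
  have [A [B [FA FB AB0]]] := sepF _ _ ij.
  have [U [oU FU UA]] := (members_open (F i)).2 _ FA.
  have [V [oV FV VB]] := (members_open (F j)).2 _ FB.
  exists [set z : simple_ext | match z with inl x => U x | inr k => k = i end].
  exists [set z : simple_ext | match z with inl x => V x | inr k => k = j end].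
  split => //; [exact: simple_ext_open_inr|exact: simple_ext_open_inr|].
  case=> [z /= /UA Az /VB Bz|k /= -> //].
  by have : (A `&` B) z by []; rewrite AB0.
Qed.

(* A free open filter on the extension would trace on X a free open filter,
   hence lie below a free open ultrafilter, which then converges to a new
   point. *)
Lemma simple_ext_H_closed :
    (forall p, open_ultrafilter p -> free p -> exists i, members (F i) `<=` p) ->
  H_closed simple_ext.
Proof.
move=> ultraF; apply/seteqP; split=> // G [[GF oG] fG].
pose D := [set U | exists W, [/\ open W, G W & U = simple_inl @^-1` W]].
have oD : open_filter (filter_from D id).
  apply: open_filter_from => [|? ?|?].
  - by exists setT, setT; split => //; [exact: openT | exact: filterT].
  - move=> [W [oW GW ->]] [W' [oW' GW' ->]].
    by exists (W `&` W'); split => //; [exact: openI | exact: filterI].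
  - move=> [W [oW GW ->]]; split; first by case: oW.
    have [|z [Wz [x _ xz]]] := simple_inl_dense _ oW; first exact: filter_ex GW.
    by exists x; rewrite /preimage /= xz.
have DG A : G A -> filter_from D id (simple_inl @^-1` A).
  move=> /oG[W [oW GW WA]]; exists (simple_inl @^-1` W); first by exists W.
  by move=> x /WA.
have fD : free (filter_from D id).
  move=> x; have [W [oW Wx GnW]] := fG (inl x).
  exists (simple_inl @^-1` W); split=> //; [by case: oW | exact: DG GnW].
have [p up Dp] := open_ultrafilter_above oD.
have [i Fp] := ultraF _ up (free_sub Dp fD).
have [W [[_ FW] Wi GnW]] := fG (inr i).
by apply: (open_filter_setCF up.1 (Fp _ (FW _ Wi))); apply: Dp; exact: DG GnW.
Qed.

End SimpleExtension.

(** * Traces on X of the points of an H-extension *)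

Section Traces.
Variable X : topologicalType.
Implicit Types (Y Z : Hext X).

Definition trace Y (y : Y) : set_system X :=
  [set A | exists V : set Y, [/\ open V, V y & Hext_emb Y @^-1` V `<=` A]].

Lemma Hext_dense_ex Y (V : set Y) :
  open V -> V !=set0 -> exists x, V (Hext_emb Y x).
Proof.
by move=> oV V0; have [z [Vz [x _ xz]]] := @Hext_dense _ Y V V0 oV; exists x; rewrite xz.
Qed.

Lemma Hext_emb_continuous Y : continuous (Hext_emb Y).
Proof. by case: (Hext_embedding Y). Qed.

Lemma trace_open_filter Y (y : Y) : open_filter (trace y).
Proof.
split; first split.
- move=> [V [oV Vy V0]].
  have [|x Vx] := Hext_dense_ex oV; first by exists y.
  exact: V0 Vx.
- split=> [|A B [V [oV Vy VA]] [W [oW Wy WB]]|A B AB [V [oV Vy VA]]].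
  + by exists setT; split => //; exact: openT.
  + exists (V `&` W); split=> [|//|x [/VA Ax /WB]//].
    exact: openI.
  + by exists V; split=> // x /VA/AB.
move=> A [V [oV Vy VA]]; exists (Hext_emb Y @^-1` V); split => //.
  by move/continuousP: (@Hext_emb_continuous Y); exact.
by exists V; split.
Qed.

Lemma trace_free Y (y : Y) : ~ range (Hext_emb Y) y -> free (trace y).
Proof.
move=> ny x.
have /hausdorffP := @Hext_hausdorff _ Y => /(_ (Hext_emb Y x) y)[].
  by move=> E; apply: ny; exists x.
move=> A [B [oA oB Ax By AB]]; exists (Hext_emb Y @^-1` A); split => //.
  by move/continuousP: (@Hext_emb_continuous Y); exact.
by exists B; split=> // z Bz Az; exact: AB Az Bz.
Qed.

(** Limits are unique in a Hausdorff space: disjoint neighbourhoods of y and z would both have their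
    traces in p. *)
Lemma trace_inj Y (y z : Y) p :
  open_filter p -> trace y `<=` p -> trace z `<=` p -> y = z.
Proof.
move=> [pF _] yp zp; apply: contrapT => yz.
have /hausdorffP := @Hext_hausdorff _ Y => /(_ _ _ yz)[A [B [oA oB Ay Bz AB]]].
have pA : p (Hext_emb Y @^-1` A) by apply: yp; exists A; split.
have pB : p (Hext_emb Y @^-1` B) by apply: zp; exists B; split.
by have [x [Ax Bx]] := filter_ex (filterI pA pB); exact: AB Ax Bx.
Qed.

Lemma free_trace_nrange Y (y : Y) p :
  open_filter p -> free p -> trace y `<=` p -> ~ range (Hext_emb Y) y.
Proof.
move=> op fp yp [x _ xy]; have [U [oU Ux pnU]] := fp x.
apply: (open_filter_setCF op _ pnU); apply: yp.
have [_ _ /(_ _ oU)[V oV E]] := Hext_embedding Y.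
by exists V; rewrite -E -xy; split => //; rewrite E in Ux.
Qed.

(** The open sets of Y with trace in p generate an open filter, which cannot be free because Y is
    H-closed. A point where freeness fails is a limit of p. *)
Lemma open_ultrafilter_limit Y p :
  open_ultrafilter p -> exists y : Y, trace y `<=` p.
Proof.
move=> [op up]; have [pF _] := op.
pose D := [set W : set Y | open W /\ p (Hext_emb Y @^-1` W)].
have oD : open_filter (filter_from D id).
  apply: open_filter_from => [|U V|U].
  - by exists setT; split; [exact: openT | exact: filterT].
  - by move=> [oU pU] [oV pV]; split; [exact: openI | exact: filterI].
  - by move=> [oU pU]; split=> //; have [x Ux] := filter_ex pU; exists (Hext_emb Y x).
have nfD : ~ free (filter_from D id).
  move=> fD; have /seteqP[+ _] := @Hext_H_closed _ Y.
  by move=> /(_ (filter_from D id)); apply.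
have /existsNP[y ny] := nfD; exists y => A [V [oV Vy VA]].
apply: filterS VA _.
have oU : open (Hext_emb Y @^-1` V).
  by move/continuousP: (@Hext_emb_continuous Y); exact.
have [//|/op.2[U' [oU' pU' U'V]]] := up _ oU.
have [_ _ /(_ _ oU')[W oW E]] := Hext_embedding Y.
exfalso; apply: ny; exists V; split => //; exists W; first by split; rewrite -?E.
move=> z Wz Vz.
have [||x [Wx Vx]] := @Hext_dense_ex Y (W `&` V).
- exact: openI.
- by exists z.
- by rewrite E in U'V; exact: (U'V _ Wx).
Qed.

End Traces.

(** * Simple extensions as H-extensions, and maps out of them *)

Section SimpleHext.
Variables (X : topologicalType) (X_hausdorff : hausdorff_space X).
Variables (I : Type) (F : I -> OF X).
Hypothesis F_sep : forall i j, i <> j -> exists A B,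
  [/\ members (F i) A, members (F j) B & A `&` B = set0].
Hypothesis F_ultra : forall p, open_ultrafilter p -> free p ->
  exists i, members (F i) `<=` p.

Definition simple_Hext : Hext X :=
  MkHext (simple_ext_hausdorff X_hausdorff F_sep) (simple_ext_H_closed F_ultra)
    (simple_inl_embedding F) (@simple_inl_dense X I F).

(** The map is the embedding on X and h on the new points; the condition on traces is its continuity
    at the new points. *)
Lemma Hext_le_simple (Y : Hext X) (h : I -> Y) :
    (forall i, trace (h i) `<=` members (F i)) ->
    (forall y, ~ range (Hext_emb Y) y -> exists i, h i = y) ->
  Hext_le Y simple_Hext.
Proof.
move=> hF h_surj.
exists (fun z : simple_ext F =>
  match z with inl x => Hext_emb Y x | inr i => h i end).
split=> // [|y].
  apply/continuousP => V oV; split=> [|i /= Vhi].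
    by move/continuousP: (@Hext_emb_continuous _ Y); exact.
  by apply: hF; exists V; split.
have [[x _ <-]|/h_surj[i <-]] := pselect (range (Hext_emb Y) y).
  by exists (inl x).
by exists (inr i).
Qed.

End SimpleHext.

(** * The Katetov extension as the maximum of H(X) *)

Section Katetov.
Variables (X : topologicalType) (X_hausdorff : hausdorff_space X).

Definition free_ultra : Type := {F : OF X | open_ultrafilter (members F)}.

Lemma free_ultra_sep (i j : free_ultra) : i <> j -> exists A B,
  [/\ members (sval i) A, members (sval j) B & A `&` B = set0].
Proof.
case: i j => [F uF] [G uG] /= FG; have [GF _] := uG.1.
have [GsF|/existsNP[A /not_implyP[GA nFA]]] :=
    pselect (members G `<=` members F).
  case: FG; apply: eq_exist; apply: members_inj.
  exact: open_ultrafilter_max uG (members_open F) GsF.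
have [U [oU GU UA]] := uG.1.2 _ GA.
have [FU|FnU] := uF.2 _ oU.
  by case: nFA; have [FF _] := uF.1; exact: filterS FU.
by exists (~` U), U; rewrite setICl.
Qed.

Lemma free_ultra_ultra p : open_ultrafilter p -> free p ->
  exists i : free_ultra, members (sval i) `<=` p.
Proof. by move=> up fp; exists (exist _ (mkOF up.1 fp) up). Qed.

Definition Katetov : Hext X :=
  simple_Hext X_hausdorff free_ultra_sep free_ultra_ultra.

(** Each free open ultrafilter is sent to its limit in Y. Every remainder point y is reached, since
    its trace is free and lies below some free open ultrafilter, whose limit is y. *)
Lemma Katetov_max (Y : Hext X) : Hext_le Y Katetov.
Proof.
have lim (i : free_ultra) : {y : Y | trace y `<=` members (sval i)}.
  exact/cid/open_ultrafilter_limit/(svalP i).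
apply: (@Hext_le_simple _ _ _ _ _ _ _ (fun i => sval (lim i))) => [i|y ny].
  exact: svalP (lim i).
have [p up yp] := open_ultrafilter_above (trace_open_filter y).
have fp := free_sub yp (trace_free ny).
exists (exist _ (mkOF up.1 fp) up : free_ultra).
case: (lim _) => z /= zp; exact: trace_inj up.1 zp yp.
Qed.

Lemma H_iso_almost_H_closed :
  order_isomorphic (@H_le X) (fun F G : OF X => (F <= G)%O) -> almost_H_closed X.
Proof.
move=> [f [[g fK gK] f_le]].
apply: directed_almost_H_closed => [|F G]; first by exists (f (H_class Katetov)).
exists (f (H_class Katetov)); rewrite -(gK F) -(gK G).
have [Y ->] := H_class_surj (g F); have [Z ->] := H_class_surj (g G).
by split; apply/f_le/H_leE; exact: Katetov_max.
Qed.

End Katetov.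

(** * One-point H-extensions under a unique free open ultrafilter *)

Section OnePoint.
Variables (X : topologicalType) (X_hausdorff : hausdorff_space X).
Variable p : set_system X.
Hypotheses (up : open_ultrafilter p) (fp : free p).
Hypothesis p_unique : forall q, open_ultrafilter q /\ free q -> p = q.
Implicit Types F G : OF X.

Lemma one_point_sep F (i j : unit) : i <> j -> exists A B,
  [/\ members F A, members F B & A `&` B = set0].
Proof. by case: i; case: j. Qed.

Lemma one_point_ultra F q : open_ultrafilter q -> free q ->
  exists i : unit, members F `<=` q.
Proof.
by move=> uq fq; exists tt; rewrite -(p_unique (conj uq fq)); exact: almost_top.
Qed.

Definition one_point F : Hext X :=
  simple_Hext X_hausdorff (@one_point_sep F) (@one_point_ultra F).

Lemma one_point_le F G : Hext_le (one_point F) (one_point G) <-> (F <= G)%O.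
Proof.
split=> [[f [cf sf fE]]|/members_leE FG]; last first.
  apply: (@Hext_le_simple _ _ _ _ _ _ (one_point F) (fun=> inr tt)) => [_ A|].
    move=> [V [[oV FV] Vi VA]]; have [[GF _] _] := membersP G.
    by apply: filterS VA _; apply: FG; exact: FV Vi.
  by move=> [x ny|[] _]; [case: ny; exists x | exists tt].
(* Some point is sent to the new point by surjectivity, and it is not in X, whose points are
   fixed. *)
have ftt : f (inr tt) = inr tt.
  have [[x|[]]] := sf (inr tt); last by [].
  by have := fE x => /= ->.
apply/members_leE => A FA; have [U [oU FU UA]] := (members_open F).2 _ FA.
have oW := simple_ext_open_inr (F := fun=> F) (i := tt) oU FU.
have [_ /(_ tt)] := (continuousP _).1 cf _ oW.
rewrite /preimage /= ftt => /(_ erefl) GU; have [[GF _] _] := membersP G.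
apply: filterS GU => x; have := fE x => /= ->; exact: UA.
Qed.

(** Both traces are free open filters, hence lie below p, so y and z are limits of the same
    filter. *)
Lemma remainder_unique (Y : Hext X) (y z : Y) :
  ~ range (Hext_emb Y) y -> ~ range (Hext_emb Y) z -> y = z.
Proof.
move=> ny nz.
apply: (@trace_inj _ _ _ _ p up.1).
- exact: (almost_top p_unique (F := mkOF (trace_open_filter y) (trace_free ny))).
- exact: (almost_top p_unique (F := mkOF (trace_open_filter z) (trace_free nz))).
Qed.

(** F is the trace of the only remainder point y, the limit of p. By antisymmetry, a map in each
    direction is enough. *)
Lemma one_point_surj (Y : Hext X) : exists F, Hext_equiv Y (one_point F).
Proof.
have [y yp] := open_ultrafilter_limit Y up.
have ny := free_trace_nrange up.1 fp yp.
pose F := mkOF (trace_open_filter y) (trace_free ny).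
exists F; apply: Hext_le_anti.
  apply: (@Hext_le_simple _ _ _ _ _ _ Y (fun=> y)) => [_ //|z nz].
  by exists tt; exact: remainder_unique.
have [e_inj _ e_open] := Hext_embedding Y.
pose f (z : Y) : simple_ext (fun _ : unit => F) :=
  if pselect (exists x, Hext_emb Y x = z) is left xz then inl (sval (cid xz))
  else inr tt.
have fE x : f (Hext_emb Y x) = inl x.
  rewrite /f; case: pselect => [xz|[]]; last by exists x.
  by case: cid => x' /= /e_inj ->.
have fy z : ~ range (Hext_emb Y) z -> f z = inr tt.
  by rewrite /f => nz; case: pselect => // -[x xz]; case: nz; exists x.
exists f; split=> [|[x|[]]|//].
- apply/continuousP => W [/e_open[V oV UV] FU]; rewrite openE => z Wfz.
  have WV x : W (inl x) = V (Hext_emb Y x) := congr1 (@^~ x) UV.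
  rewrite /interior nbhsE.
  have [[x _ xz]|nz] := pselect (range (Hext_emb Y) z).
    have /hausdorffP/(_ z y)[] := @Hext_hausdorff _ Y.
      by move=> zy; case: (ny); exists x; rewrite // xz.
    (* Intersecting with A excludes y, so that only points of X remain and V controls them. *)
    move=> A [B [oA _ Az By AB]]; exists (V `&` A).
      split; first exact: openI.
      by split=> //; rewrite -xz -WV -fE xz.
    move=> w [Vw Aw]; have [[x' _ wx']|nw] := pselect (range (Hext_emb Y) w).
      by move: Vw; rewrite -wx' -WV /= fE.
    by case: (AB _ Aw); rewrite (remainder_unique nw ny).
  (* Here z is y, and membership of the trace of W in F yields a neighbourhood of y directly. *)
  rewrite /= fy // in Wfz; have [V' [oV' V'y V'U]] := FU _ Wfz.
  exists V' => [|w V'w]; first by rewrite (remainder_unique nz ny).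
  have [[x _ wx]|nw] := pselect (range (Hext_emb Y) w); last by rewrite /= fy.
  by rewrite -wx /= fE; apply: V'U; rewrite /preimage /= wx.
- by exists (Hext_emb Y x); rewrite fE.
- by exists y; rewrite fy.
Qed.

End OnePoint.

Theorem theorem3p8 (X : topologicalType)
    (X_hausdorff : hausdorff_space X) (X_infinite : infinite_set [set: X]) :
  [<-> almost_H_closed X;
       order_isomorphic (@H_le X) (fun F G : OF X => (F <= G)%O);
       is_complete_distributive_lattice (OF X);
       is_lattice (OF X)].
Proof.
split; last split; last split.
- move=> [p [[up fp] p_unique]].
  pose g F := H_class (one_point X_hausdorff p_unique F).
  have g_le F G : H_le (g F) (g G) <-> (F <= G)%O.
    by split=> [/H_leE/one_point_le|/one_point_le FG]; last exact/H_leE.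
  have g_surj C : exists F, g F = C.
    have [Y ->] := H_class_surj C.
    have [F YF] := one_point_surj X_hausdorff up fp p_unique Y.
    by exists F; apply/H_classP; exact: Hext_equiv_sym.
  pose f C := sval (cid (g_surj C)).
  have fK : cancel f g by move=> C; exact: svalP (cid (g_surj C)).
  exists f; split; last by move=> C D; rewrite -{1}(fK C) -{1}(fK D).
  (* [g] reflects the order, so it is injective by antisymmetry and its section [f] is a two-sided
     inverse. *)
  exists g => // F; apply/eqP; rewrite eq_le; apply/andP.
  by split; apply/g_le; rewrite fK; exact: H_le_refl.
- move=> /(H_iso_almost_H_closed X_hausdorff)[p [[up fp] p_unique]].
  exact: almost_complete_distributive up fp p_unique.
- by move=> [OF0 _ [meet [join [ops _]]]]; split=> //; exists meet, join.
- move=> [OF0 [meet [join ops]]]; apply: directed_almost_H_closed => // F G.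
  have [_ [ub _]] := ops F G.
  by exists (join F G); split; apply: ub; [left | right].
Qed.
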